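(* Let $\sigma\subset N_{\mathbb{Q}}$ be a strongly convex polyhedral cone, $n=\dim N_{\mathbb{Q}}$, and $P\in\operatorname{Pol}_{\sigma^\vee}(M)$. Then for every positive integer $e\ge n-1$ the polyhedron $eP$ is normal. In particular, every $\mathbb{T}$-stable integrally closed ideal of an affine toric surface $\operatorname{Spec}\mathbf{k}[\sigma^\vee\cap M]$ is normal.
   Context: $\mathbf{k}$ is algebraically closed of characteristic $0$; $M,N$ dual lattices. $\operatorname{Pol}_{\sigma^\vee}(M)$ is the set of polyhedra $P=Q+\sigma^\vee\subset M_{\mathbb{Q}}$ with $Q$ a polytope whose vertices lie in $M$. For $e\ge1$, $eP$ is the image of $P$ under the homothety of ratio $e$. $P$ is normal if for every integer $e\ge1$, $(eP)\cap M=\{m_1+\dots+m_e: m_1,\dots,m_e\in P\cap M\}$. An ideal $I$ of a domain is normal if $I^i$ is integrally closed for all $i\ge1$. *)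

(* Defs.v *)
(* M = Z^n (row vectors over int), M_Q = N_Q = Q^n (row vectors
   over rat), with the standard pairing <m,v> = sum_i m_i v_i. *)
From HB Require Import structures.
From mathcomp Require Import all_boot all_order all_algebra.
Set Implicit Arguments. Unset Strict Implicit. Unset Printing Implicit Defensive.
Import Order.TTheory GRing.Theory Num.Theory.
Local Open Scope ring_scope.

Definition lat n (m : 'rV[int]_n) : 'rV[rat]_n := map_mx (fun z : int => z%:~R) m.

Definition pair n (m v : 'rV[rat]_n) : rat := \sum_(i < n) m 0 i * v 0 i.

Definition in_cone n (gens : seq 'rV[rat]_n) (v : 'rV[rat]_n) : Prop :=
  exists a : 'I_(size gens) -> rat,
    (forall i, 0 <= a i) /\ v = \sum_(i < size gens) a i *: nth 0 gens i.

Definition strongly_convex n (gens : seq 'rV[rat]_n) : Prop :=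
  forall v, in_cone gens v -> in_cone gens (- v) -> v = 0.

Definition in_dual n (gens : seq 'rV[rat]_n) (m : 'rV[rat]_n) : Prop :=
  forall v, in_cone gens v -> 0 <= pair m v.

Definition in_conv n (vs : seq 'rV[int]_n) (x : 'rV[rat]_n) : Prop :=
  exists l : 'I_(size vs) -> rat,
    [/\ forall i, 0 <= l i, \sum_(i < size vs) l i = 1 &
        x = \sum_(i < size vs) l i *: lat (nth 0 vs i)].

Definition polyh n (vs : seq 'rV[int]_n) (gens : seq 'rV[rat]_n)
  (x : 'rV[rat]_n) : Prop :=
  exists q c, in_conv vs q /\ in_dual gens c /\ x = q + c.

Definition homot n (e : nat) (P : 'rV[rat]_n -> Prop) (x : 'rV[rat]_n) : Prop :=
  exists y, P y /\ x = e%:R *: y.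

Definition normal_polyh n (P : 'rV[rat]_n -> Prop) : Prop :=
  forall e : nat, (0 < e)%N -> forall m : 'rV[int]_n,
    homot e P (lat m) <->
    exists ms : 'I_e -> 'rV[int]_n,
      (forall j, P (lat (ms j))) /\ m = \sum_(j < e) ms j.

(* Main.v *)
(* Write a lattice point x of (k+1)E.P as sum_i lam_i v_i + c, with v_i vertices
   of P, lam_i >= 0 of total weight (k+1)E and c in sigma^vee.  By Caratheodory in
   the homogenization, the v_i with lam_i <> 0, together with c if it occurs, are
   affinely independent, so there are at most n + 1 of them.  If the fractional
   parts {lam_i} sum to at most E, integers r_i <= floor lam_i of total kE split x
   as (x - sum_i r_i v_i) + sum_i r_i v_i, a point of E.P plus a point of kE.P.
   As sum_i {lam_i} is an integer smaller than the number of vertices used, this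
   only fails when x = sum_i lam_i v_i over the n + 1 vertices of a simplex with
   sum_i {lam_i} = n.  Then z = sum_i (floor lam_i + 1) v_i - x = sum_i (1 - {lam_i}) v_i
   is a lattice point of P, and trading a suitable vertex v_j for z keeps x in the
   cone over the simplex while multiplying its normalized volume by 1 - {lam_j} < 1;
   induct on that volume.  Peeling off lattice points of E.P one at a time proves
   that E.P is normal. *)

Require Import Defs.
From HB Require Import structures.
From mathcomp Require Import all_boot all_order all_algebra.
From mathcomp Require Import ring lra zify.
From Stdlib Require Import Classical.
Import Order.TTheory GRing.Theory Num.Theory.
Local Open Scope ring_scope.
Set Implicit Arguments. Unset Strict Implicit. Unset Printing Implicit Defensive.

Lemma pairDl n (a b v : 'rV[rat]_n) : pair (a + b) v = pair a v + pair b v.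
Proof. by rewrite /pair -big_split; apply: eq_bigr => i _; rewrite mxE mulrDl. Qed.

Lemma pairZl n c (a v : 'rV[rat]_n) : pair (c *: a) v = c * pair a v.
Proof. by rewrite /pair mulr_sumr; apply: eq_bigr => i _; rewrite mxE mulrA. Qed.

Lemma pair0l n (v : 'rV[rat]_n) : pair 0 v = 0.
Proof. by rewrite /pair big1 // => i _; rewrite mxE mul0r. Qed.

Section DualCone.
Variables (n : nat) (gens : seq 'rV[rat]_n).

Lemma in_dual0 : in_dual gens 0.
Proof. by move=> v _; rewrite pair0l. Qed.

Lemma in_dualD a b : in_dual gens a -> in_dual gens b -> in_dual gens (a + b).
Proof. by move=> Ha Hb v Hv; rewrite pairDl addr_ge0 ?Ha ?Hb. Qed.

Lemma in_dualZ c a : 0 <= c -> in_dual gens a -> in_dual gens (c *: a).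
Proof. by move=> c_ge0 Ha v Hv; rewrite pairZl mulr_ge0 ?Ha. Qed.

Lemma in_dual_sum (I : finType) (mu : I -> rat) (c : I -> 'rV[rat]_n) :
  (forall i, 0 <= mu i) -> (forall i, in_dual gens (c i)) ->
  in_dual gens (\sum_i mu i *: c i).
Proof.
move=> mu_ge0 dual_c; apply: (big_ind (in_dual gens)).
- exact: in_dual0.
- exact: in_dualD.
- by move=> i _; apply: in_dualZ.
Qed.

End DualCone.

Lemma latB n (a b : 'rV[int]_n) : lat (a - b) = lat a - lat b.
Proof. by rewrite /lat raddfB. Qed.

Lemma latMn n (a : 'rV[int]_n) k : lat (a *+ k) = k%:R *: lat a.
Proof. by rewrite /lat raddfMn scaler_nat. Qed.

Lemma lat_sum n (I : finType) (F : I -> 'rV[int]_n) :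
  lat (\sum_i F i) = \sum_i lat (F i).
Proof. by rewrite /lat raddf_sum. Qed.

Lemma in_conv_comb n (vs : seq 'rV[int]_n) (I : finType) (mu : I -> rat)
    (q : I -> 'rV[rat]_n) :
  (forall i, 0 <= mu i) -> \sum_i mu i = 1 -> (forall i, in_conv vs (q i)) ->
  in_conv vs (\sum_i mu i *: q i).
Proof.
move=> mu_ge0 mu_sum1 /fin_all_exists[lam conv_q].
exists (fun l => \sum_i mu i * lam i l); split.
- move=> l; apply: sumr_ge0 => i _.
  by case: (conv_q i) => lam_ge0 _ _; rewrite mulr_ge0.
- rewrite exchange_big /= -[RHS]mu_sum1; apply: eq_bigr => i _.
  by case: (conv_q i) => _ lam_sum1 _; rewrite -mulr_sumr lam_sum1 mulr1.
- rewrite (eq_bigr (fun i => \sum_l (mu i * lam i l) *: lat (nth 0 vs l))).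
    rewrite exchange_big /=; apply: eq_bigr => l _; by rewrite scaler_suml.
  move=> i _; case: (conv_q i) => _ _ ->; rewrite scaler_sumr.
  by apply: eq_bigr => l _; rewrite scalerA.
Qed.

Definition fract (x : rat) : rat := x - (Num.truncn x)%:R.

Lemma fract0 : fract 0 = 0.
Proof. by rewrite /fract truncn0 subrr. Qed.

Lemma fract_lt1 x : 0 <= x -> fract x < 1.
Proof. by move=> /truncn_itv/andP[_]; rewrite ltrBlDr addrC natr1. Qed.

Lemma sum_fract (I : finType) (lam : I -> rat) :
  \sum_i fract (lam i) = \sum_i lam i - (\sum_i Num.truncn (lam i))%:R.
Proof. by rewrite sumrB natr_sum. Qed.

Lemma sum_fract_lt (I : finType) (S : {set I}) (lam : I -> rat) :
  (forall i, 0 <= lam i) -> (forall i, i \notin S -> lam i = 0) -> S != set0 ->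
  \sum_i fract (lam i) < #|S|%:R.
Proof.
move=> lam_ge0 lam_out /set0Pn[i0 Si0].
rewrite (bigID (mem S)) /= [X in _ + X]big1 ?addr0; last first.
  by move=> i /lam_out ->; rewrite fract0.
rewrite -sum1_card natr_sum; apply: ltr_sum => [|i _]; last exact: fract_lt1.
by apply/hasP; exists i0; rewrite ?mem_index_enum.
Qed.

Lemma exists_subsum_eq (I : finType) (a : I -> nat) T :
  (T <= \sum_i a i)%N ->
  exists2 r : I -> nat, (forall i, r i <= a i)%N & (\sum_i r i)%N = T.
Proof.
elim: T => [_|T IH le_T]; first by exists (fun _ => 0%N); rewrite ?big1.
have [r le_ra sum_r] := IH (ltnW le_T).
have [i lt_ri] : exists i, (r i < a i)%N.
  apply/existsP; apply: contraTT le_T; rewrite negb_exists => /forallP ge_ra.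
  by rewrite -ltnNge ltnS -sum_r; apply: leq_sum => i _; rewrite leqNgt ge_ra.
exists (fun j => if j == i then (r j).+1 else r j).
  by move=> j; case: eqP => [->|]; [|rewrite le_ra].
rewrite (bigD1 i) //= eqxx (eq_bigr r) => [|j /negbTE -> //].
by rewrite -sum_r [in RHS](bigD1 i) //= addSn.
Qed.

Lemma sum_enum_supp (V : nmodType) (I : finType) (S : {set I}) m (card_S : #|S| = m)
    (F : I -> V) :
  (forall i, i \notin S -> F i = 0) ->
  \sum_i F i = \sum_(j < m) F (enum_val (cast_ord (esym card_S) j)).
Proof.
move=> F_out; subst m; rewrite (bigID (mem S)) /= [X in _ + X]big1 ?addr0 //.
by rewrite (big_enum_val F); apply: eq_bigr => j _; rewrite cast_ord_id.
Qed.

Lemma card_supp_ord_recl (T : eqType) (a : T) N (f : 'I_N.+1 -> T) :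
  #|[set i | f i != a]| = ((f ord0 != a) + #|[set l | f (lift ord0 l) != a]|)%N.
Proof.
rewrite -!sum1_card !big_mkcond /= big_ord_recl !inE; congr (_ + _)%N.
by rewrite [RHS]big_mkcond; apply: eq_bigr => l _; rewrite !inE.
Qed.

Section Caratheodory.
Variables (R : realFieldType) (I : finType) (p : nat) (g : I -> 'rV[R]_p).

Definition supp_free (mu : I -> R) :=
  forall nu : I -> R, (forall i, mu i = 0 -> nu i = 0) ->
    \sum_i nu i *: g i = 0 -> forall i, nu i = 0.

Lemma supp_shrink (mu : I -> R) : (forall i, 0 <= mu i) -> ~ supp_free mu ->
  exists mu2 : I -> R, [/\ forall i, 0 <= mu2 i,
    \sum_i mu2 i *: g i = \sum_i mu i *: g i &
    [set i | mu2 i != 0] \proper [set i | mu i != 0]].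
Proof.
move=> mu_ge0 /not_all_ex_not[nu /not_all_ex_not[supp_nu /not_all_ex_not[dep_nu]]].
move=> /not_all_ex_not[i0 /eqP nu_i0].
wlog nu_gt0 : nu supp_nu dep_nu nu_i0 / 0 < nu i0.
  move=> wlog_nu; case: (ltrgtP (nu i0) 0) => [nu_lt0|nu_gt0|/eqP]; last by rewrite (negbTE nu_i0).
    apply: (wlog_nu (fun i => - nu i)); rewrite ?oppr_gt0 ?oppr_eq0 //.
      by move=> i /supp_nu ->; rewrite oppr0.
    by under eq_bigr do rewrite scaleNr; rewrite sumrN dep_nu oppr0.
  exact: (wlog_nu nu).
have [j nu_j_gt0 min_j] := @arg_minP _ _ _ i0 (fun i => 0 < nu i) (fun i => mu i / nu i) nu_gt0.
pose t := mu j / nu j.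
exists (fun i => mu i - t * nu i); split.
- move=> i; rewrite subr_ge0; case: (ltrP 0 (nu i)) => [nu_i_gt0|nu_i_le0].
    by rewrite -ler_pdivlMr // min_j.
  by apply: le_trans (mu_ge0 i); rewrite mulr_ge0_le0 // divr_ge0 // ltW.
- under eq_bigr do rewrite scalerBl -scalerA.
  by rewrite sumrB -scaler_sumr dep_nu scaler0 subr0.
- apply/properP; split.
    apply/subsetP => i; rewrite !inE; apply: contra => /eqP mu_i0.
    by rewrite mu_i0 (supp_nu i mu_i0) mulr0 subr0.
  exists j; rewrite !inE.
  by apply: contraTneq nu_j_gt0 => /supp_nu ->; rewrite ltxx.
by rewrite /t divfK ?subrr ?eqxx // gt_eqF.
Qed.

Lemma caratheodory (mu : I -> R) : (forall i, 0 <= mu i) ->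
  exists mu' : I -> R, [/\ forall i, 0 <= mu' i,
    \sum_i mu' i *: g i = \sum_i mu i *: g i & supp_free mu'].
Proof.
move: {2}#|_| (leqnn #|[set i | mu i != 0]|) => c.
elim: c mu => [|c IH] mu supp_le mu_ge0.
  exists mu; split => // nu supp_nu _ i; apply/supp_nu/eqP.
  by move: supp_le; rewrite leqn0 cards_eq0 => /eqP/setP/(_ i); rewrite !inE => /negbFE.
have [free_mu|/(supp_shrink mu_ge0)[mu2 [mu2_ge0 sum_mu2 proper_mu2]]] := classic (supp_free mu).
  by exists mu.
have [|mu' [mu'_ge0 sum_mu' free_mu']] := IH mu2 _ mu2_ge0.
  by rewrite -ltnS (leq_trans (proper_card proper_mu2)).
by exists mu'; rewrite sum_mu'.
Qed.

Lemma supp_free_row_free (mu : I -> R) q (h : 'I_q -> I) :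
  supp_free mu -> injective h -> (forall k, mu (h k) != 0) ->
  row_free (\matrix_(k < q) g (h k)).
Proof.
move=> free_mu inj_h mu_h; apply: inj_row_free => v vM0.
pose nu i := if [pick k | h k == i] is Some k then v 0 k else 0.
have nu_h k : nu (h k) = v 0 k.
  by rewrite /nu; case: pickP => [k' /eqP/inj_h -> //|/(_ k)]; rewrite eqxx.
have nu_out i : i \notin [set h k | k in predT] -> nu i = 0.
  by rewrite /nu; case: pickP => // k /eqP <-; rewrite imset_f.
apply/rowP => k; rewrite mxE -nu_h; apply: free_mu.
  move=> i mu_i0; apply: nu_out; apply/imsetP => -[k' _ def_i].
  by move: (mu_h k'); rewrite -def_i mu_i0 eqxx.
rewrite (bigID (mem ([set h k | k in predT]))) /= [X in _ + X]big1 ?addr0; last first.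
  by move=> i /nu_out ->; rewrite scale0r.
rewrite big_imset /=; last by move=> k1 k2 _ _ /inj_h.
rewrite -[RHS]vM0 mulmx_sum_row; apply: eq_bigr => k' _.
by rewrite nu_h rowK.
Qed.

Lemma card_supp_free (mu : I -> R) : supp_free mu -> (#|[set i | mu i != 0%R]| <= p)%N.
Proof.
move=> free_mu; have: row_free (\matrix_(k < #|[set i | mu i != 0]|) g (enum_val k)).
  apply: (supp_free_row_free free_mu (@enum_val_inj _ _)) => k.
  by have := enum_valP k; rewrite inE.
by move/eqP <-; exact: rank_leq_col.
Qed.

End Caratheodory.

Definition replace_row (R : nzRingType) p (B : 'M[R]_p) j (c : 'rV[R]_p) : 'M[R]_p :=
  \matrix_(i < p) (if i == j then c *m B else row i B).

Lemma det_replace_row (R : fieldType) p (B : 'M[R]_p) j c :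
  \det (replace_row B j c) = c 0 j * \det B.
Proof.
have row'_replace c' : row' j (replace_row B j c') = row' j B.
  apply/matrixP => i k; rewrite !mxE eq_sym (negbTE (neq_lift j i)).
  by rewrite mxE.
pose u := c - c 0 j *: delta_mx 0 j.
have u_j : u 0 j = 0 by rewrite !mxE !eqxx /= mulr1 subrr.
have u_B : u *m replace_row B j u = u *m B.
  rewrite !mulmx_sum_row; apply: eq_bigr => i _; rewrite rowK.
  by case: eqP => [->|//]; rewrite u_j !scale0r.
(* the row u *m B is a combination of the other rows, u having no j-th entry *)
have det_u : \det (replace_row B j u) = 0.
  apply/eqP/det0P; exists (u - delta_mx 0 j).
    apply/eqP => /rowP/(_ j)/eqP; rewrite !mxE !eqxx /= mulr1 subrr sub0r.
    by rewrite oppr_eq0 oner_eq0.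
  by rewrite mulmxBl u_B -rowE rowK eqxx subrr.
rewrite (@determinant_multilinear _ _ _ B (replace_row B j u) j (c 0 j) 1) ?row'_replace //.
  by rewrite det_u mulr0 addr0.
rewrite !rowK !eqxx scale1r (rowE j B) scalemxAl -mulmxDl.
by rewrite /u addrC subrK.
Qed.

Definition homog (R : nzRingType) n (a : R) (v : 'rV[R]_n) : 'rV[R]_n.+1 :=
  \row_k (if unlift ord0 k is Some k' then v 0 k' else a).

Lemma homog_sum (R : nzRingType) n (I : finType) (c a : I -> R) (v : I -> 'rV[R]_n) :
  \sum_i c i *: homog (a i) (v i) = homog (\sum_i c i * a i) (\sum_i c i *: v i).
Proof.
apply/rowP => k; rewrite summxE mxE.
by case def_k: (unlift ord0 k) => [k'|]; rewrite ?summxE; apply: eq_bigr => i _;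
  rewrite !mxE def_k.
Qed.

Lemma homog_inj (R : nzRingType) n a b (v w : 'rV[R]_n) :
  homog a v = homog b w -> a = b /\ v = w.
Proof.
move=> eq_ab; split.
  by have := congr1 (fun u : 'rV[R]_n.+1 => u 0 ord0) eq_ab; rewrite !mxE unlift_none.
apply/rowP => k; have := congr1 (fun u : 'rV[R]_n.+1 => u 0 (lift ord0 k)) eq_ab.
by rewrite !mxE liftK.
Qed.

Definition vertex_mx n (W : 'I_n.+1 -> 'rV[int]_n) : 'M[int]_n.+1 :=
  \matrix_(i, k) (if unlift ord0 k is Some k' then W i 0 k' else 1).

Lemma map_vertex_mx n (W : 'I_n.+1 -> 'rV[int]_n) :
  map_mx (fun z : int => z%:~R) (vertex_mx W) = \matrix_i homog 1 (lat (W i)) :> 'M[rat]_n.+1.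
Proof. by apply/matrixP => i k; rewrite !mxE; case: unlift => [k'|] //=; rewrite mxE. Qed.

Lemma comb_exchange (R : realFieldType) (V : lmodType R) (I : finType) (i0 : I)
    (w : I -> V) (lam mu : I -> R) :
  (forall i, 0 <= lam i) -> (forall i, 0 < mu i) -> \sum_i mu i = 1 ->
  exists j, exists2 lam' : I -> R,
    [/\ forall i, 0 <= lam' i & \sum_i lam' i = \sum_i lam i] &
    \sum_i lam i *: w i = \sum_i lam' i *: (if i == j then \sum_l mu l *: w l else w i).
Proof.
move=> lam_ge0 mu_gt0 mu_sum1.
have [j _ min_j] := @arg_minP _ _ _ i0 predT (fun i => lam i / mu i) erefl.
pose t := lam j / mu j.
have gap_j : lam j - t * mu j = 0 by rewrite /t divfK ?subrr // gt_eqF.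
have sum_off_j (U : zmodType) (F : I -> U) :
    F j = 0 -> \sum_(i | i != j) F i = \sum_i F i.
  by move=> Fj0; rewrite [RHS](bigD1 j) //= Fj0 add0r.
exists j, (fun i => if i == j then t else lam i - t * mu i); first split.
- move=> i; case: eqP => _; first by rewrite divr_ge0 // ltW.
  by rewrite subr_ge0 -ler_pdivlMr // min_j.
- rewrite (bigD1 j) //= eqxx (eq_bigr (fun i => lam i - t * mu i)) => [|i /negbTE -> //].
  by rewrite sum_off_j // sumrB -mulr_sumr mu_sum1 mulr1 addrC subrK.
rewrite [RHS](bigD1 j) //= eqxx.
rewrite [X in _ = _ + X](eq_bigr (fun i => (lam i - t * mu i) *: w i)) => [|i /negbTE -> //].
rewrite sum_off_j ?gap_j ?scale0r // scaler_sumr -big_split /=.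
by apply: eq_bigr => i _; rewrite scalerBl scalerA addrC subrK.
Qed.

Lemma det_vertex_mx_exchange n (W : 'I_n.+1 -> 'rV[int]_n) (mu : 'I_n.+1 -> rat) j z :
  \sum_i mu i = 1 -> lat z = \sum_i mu i *: lat (W i) ->
  (\det (vertex_mx (fun i => if i == j then z else W i)))%:~R
    = mu j * (\det (vertex_mx W))%:~R :> rat.
Proof.
move=> mu_sum1 lat_z; rewrite -!det_map_mx !map_vertex_mx.
have -> : mu j = (\row_i mu i) 0 j by rewrite mxE.
rewrite -det_replace_row; congr (\det _).
apply/row_matrixP => i; rewrite !rowK; case: eqP => // _.
rewrite mulmx_sum_row (eq_bigr (fun l => mu l *: homog 1 (lat (W l)))); last first.
  by move=> l _; rewrite rowK mxE.
rewrite homog_sum lat_z [in RHS](eq_bigr mu) ?mu_sum1 // => l _.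
by rewrite mulr1.
Qed.

Lemma absz_lt_scale (d d' : int) (c : rat) :
  d'%:~R = c * d%:~R -> d != 0 -> 0 < c < 1 -> (0 < absz d' < absz d)%N.
Proof.
move=> def_d' d_neq0 /andP[c_gt0 c_lt1].
have d_gt0 : 0 < `|d%:~R : rat| by rewrite normr_gt0 intr_eq0.
rewrite absz_gt0 -(intr_eq0 rat) def_d' mulf_neq0 ?intr_eq0 ?(gt_eqF c_gt0) //=.
rewrite -ltz_nat !abszE -(ltr_int rat) !intr_norm def_d' normrM (gtr0_norm c_gt0).
by rewrite -[X in _ < X]mul1r ltr_pM2r.
Qed.

Lemma sum_lt1_gt0 n (f : 'I_n.+1 -> rat) i :
  (0 < n)%N -> (forall l, f l < 1) -> \sum_l f l = n%:R -> 0 < f i.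
Proof.
move=> n_gt0 f_lt1 sum_f.
have [l0 l0_neq_i] : exists l : 'I_n.+1, l != i.
  have [->|i_neq0] := eqVneq i ord0; last by exists ord0; rewrite eq_sym.
  by exists ord_max; rewrite -val_eqE /= -lt0n.
have others_lt : \sum_(l | l != i) f l < n%:R.
  apply: (@lt_le_trans _ _ (\sum_(l | l != i) 1)).
    apply: ltr_sum => [|l _]; last exact: f_lt1.
    by apply/hasP; exists l0; rewrite ?mem_index_enum.
  by rewrite sumr_const cardC1 card_ord.
by move: sum_f; rewrite (bigD1 i) //=; lra.
Qed.

Lemma lat_comb_cofrac n (I : finType) (w : I -> 'rV[int]_n) (lam : I -> rat) x :
  lat x = \sum_i lam i *: lat (w i) ->
  lat (\sum_i w i *+ (Num.truncn (lam i)).+1 - x)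
    = \sum_i (1 - fract (lam i)) *: lat (w i).
Proof.
move=> def_x; rewrite latB lat_sum def_x -sumrB; apply: eq_bigr => i _.
by rewrite latMn -scalerBl /fract -natr1; congr (_ *: _); ring.
Qed.

Lemma homot_homot n (Q : 'rV[rat]_n -> Prop) k E x :
  homot k (homot E Q) x <-> homot (k * E) Q x.
Proof.
split; first by move=> [_ [[y [Qy ->]] ->]]; exists y; rewrite scalerA natrM.
by move=> [y [Qy ->]]; exists (E%:R *: y); split; [exists y | rewrite scalerA natrM].
Qed.

Section Polyhedron.
Variables (n : nat) (vs : seq 'rV[int]_n) (gens : seq 'rV[rat]_n).
Local Notation P := (polyh vs gens).

Lemma polyh_vertex (l : 'I_(size vs)) : P (lat (nth 0 vs l)).
Proof.
exists (lat (nth 0 vs l)), 0; split; last by split; [exact: in_dual0 | rewrite addr0].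
exists (fun i => (i == l)%:R); split.
- by move=> i; rewrite ler0n.
- by rewrite (bigD1 l) //= eqxx big1 ?addr0 // => i /negbTE ->.
- by rewrite (bigD1 l) //= eqxx scale1r big1 ?addr0 // => i /negbTE ->; rewrite scale0r.
Qed.

Lemma polyh_comb (I : finType) (mu : I -> rat) (p : I -> 'rV[rat]_n) C :
  (forall i, 0 <= mu i) -> \sum_i mu i = 1 -> (forall i, P (p i)) ->
  in_dual gens C -> P (\sum_i mu i *: p i + C).
Proof.
move=> mu_ge0 mu_sum1 /fin_all_exists[q /fin_all_exists[c Pqc]] dual_C.
exists (\sum_i mu i *: q i), (\sum_i mu i *: c i + C); split; [|split].
- by apply: in_conv_comb => // i; case: (Pqc i).
- apply: in_dualD => //; apply: in_dual_sum => // i; by case: (Pqc i) => _ [].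
- rewrite addrA -big_split /=; congr (_ + _); apply: eq_bigr => i _.
  by case: (Pqc i) => _ [_ ->]; rewrite scalerDr.
Qed.

Lemma homot_polyh_comb T (I : finType) (mu : I -> rat) (p : I -> 'rV[rat]_n) C :
  (0 < T)%N -> (forall i, 0 <= mu i) -> \sum_i mu i = T%:R ->
  (forall i, P (p i)) -> in_dual gens C -> homot T P (\sum_i mu i *: p i + C).
Proof.
move=> T_gt0 mu_ge0 mu_sum Pp dual_C.
have T_neq0 : T%:R != 0 :> rat by rewrite pnatr_eq0 -lt0n.
exists (\sum_i (mu i / T%:R) *: p i + T%:R^-1 *: C); split.
  apply: polyh_comb => //; last by apply: in_dualZ; rewrite ?invr_ge0.
    by move=> i; rewrite divr_ge0.
  by rewrite -mulr_suml mu_sum mulfV.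
rewrite scalerDr scalerA mulfV // scale1r scaler_sumr; congr (_ + _).
by apply: eq_bigr => i _; rewrite scalerA mulrC divfK.
Qed.

Lemma simplex_exchange (W : 'I_n.+1 -> 'rV[int]_n) (lam : 'I_n.+1 -> rat) x :
  (0 < n)%N -> \det (vertex_mx W) != 0 -> (forall i, P (lat (W i))) ->
  (forall i, 0 <= lam i) -> lat x = \sum_i lam i *: lat (W i) ->
  \sum_i fract (lam i) = n%:R ->
  exists W' (lam' : 'I_n.+1 -> rat),
    [/\ forall i, P (lat (W' i)), forall i, 0 <= lam' i,
        \sum_i lam' i = \sum_i lam i & lat x = \sum_i lam' i *: lat (W' i)] /\
    (0 < absz (\det (vertex_mx W')) < absz (\det (vertex_mx W)))%N.
Proof.
move=> n_gt0 det_W PW lam_ge0 def_x fract_sum.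
pose mu i := 1 - fract (lam i).
have mu_gt0 i : 0 < mu i by rewrite subr_gt0 fract_lt1.
have mu_sum1 : \sum_i mu i = 1.
  by rewrite sumrB fract_sum sumr_const card_ord -natr1 addrAC subrr add0r.
pose z := \sum_i W i *+ (Num.truncn (lam i)).+1 - x.
have lat_z : lat z = \sum_i mu i *: lat (W i) := lat_comb_cofrac def_x.
have Pz : P (lat z).
  rewrite lat_z -[X in P X]addr0; apply: polyh_comb => // [i|]; first exact: ltW.
  exact: in_dual0.
have [j [lam' [lam'_ge0 lam'_sum] def_x']] :=
  comb_exchange ord0 (fun i => lat (W i)) lam_ge0 mu_gt0 mu_sum1.
exists (fun i => if i == j then z else W i), lam'; split; first split => //.
- by move=> i; case: eqP.
- by rewrite def_x def_x' -lat_z; apply: eq_bigr => i _; rewrite (fun_if (@lat n)).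
apply: absz_lt_scale (det_vertex_mx_exchange _ mu_sum1 lat_z) det_W _.
have := sum_lt1_gt0 j n_gt0 (fun i => fract_lt1 (lam_ge0 i)) fract_sum.
by rewrite mu_gt0 /= /mu; lra.
Qed.

(* Caratheodory is applied in the cone over P x {1}: the vertices are lifted to
   height 1 and the recession direction c to height 0. *)
Definition cone_vertex_family (c : 'rV[rat]_n) (i : 'I_(size vs).+1) : 'rV[rat]_n.+1 :=
  if unlift ord0 i is Some l then homog 1 (lat (nth 0 vs l)) else homog 0 c.

Lemma sum_cone_vertex_family c (mu : 'I_(size vs).+1 -> rat) :
  \sum_i mu i *: cone_vertex_family c i =
  homog (\sum_l mu (lift ord0 l))
        (\sum_l mu (lift ord0 l) *: lat (nth 0 vs l) + mu ord0 *: c).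
Proof.
rewrite big_ord_recl /cone_vertex_family unlift_none.
under eq_bigr do rewrite liftK.
rewrite homog_sum; apply/rowP => k; rewrite !mxE.
case: (unlift ord0 k) => [k'|]; rewrite ?mulr0 ?add0r.
  by rewrite !mxE summxE addrC.
by apply: eq_bigr => l _; rewrite mulr1.
Qed.

Lemma homot_polyh_free_comb K x : homot K P (lat x) ->
  exists c (mu : 'I_(size vs).+1 -> rat),
    [/\ in_dual gens c, forall i, 0 <= mu i, supp_free (cone_vertex_family c) mu,
        \sum_l mu (lift ord0 l) = K%:R &
        lat x = \sum_l mu (lift ord0 l) *: lat (nth 0 vs l) + mu ord0 *: c].
Proof.
move=> [_ [[q [c [[lam [lam_ge0 lam_sum1 def_q]] [dual_c ->]]]] def_x]].
pose mu0 i := if unlift ord0 i is Some l then K%:R * lam l else 1.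
have mu0_ge0 i : 0 <= mu0 i by rewrite /mu0; case: unlift => // l; rewrite mulr_ge0.
have mu0_lift l : mu0 (lift ord0 l) = K%:R * lam l by rewrite /mu0 liftK.
have [mu [mu_ge0 sum_mu free_mu]] :=
  caratheodory (cone_vertex_family (K%:R *: c)) mu0_ge0.
exists (K%:R *: c), mu; move: sum_mu; rewrite !sum_cone_vertex_family.
move=> /homog_inj[-> ->]; rewrite (eq_bigr _ (fun l _ => mu0_lift l)).
rewrite (eq_bigr (fun l => K%:R *: (lam l *: lat (nth 0 vs l)))); last first.
  by move=> l _; rewrite mu0_lift scalerA.
split => //; first by apply: in_dualZ.
  by rewrite -mulr_sumr lam_sum1 mulr1.
by rewrite def_x /mu0 unlift_none scale1r -scaler_sumr -def_q scalerDr.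
Qed.

Definition splittable E k (x : 'rV[int]_n) :=
  exists2 m, homot E P (lat m) & homot (k * E) P (lat (x - m)).

Section Splitting.
Variables (E k : nat).
Hypotheses (E_gt0 : (0 < E)%N) (k_gt0 : (0 < k)%N).

Lemma splittable_floor (I : finType) (w : I -> 'rV[int]_n) (lam : I -> rat) C x :
  (forall i, P (lat (w i))) -> (forall i, 0 <= lam i) ->
  \sum_i lam i = (k.+1 * E)%:R -> in_dual gens C ->
  lat x = \sum_i lam i *: lat (w i) + C ->
  \sum_i fract (lam i) <= E%:R -> splittable E k x.
Proof.
move=> Pw lam_ge0 lam_sum dual_C def_x fract_le.
have le_kE : (k * E <= \sum_i Num.truncn (lam i))%N.
  by rewrite -(ler_nat rat); move: fract_le; rewrite sum_fract lam_sum mulSn natrD; lra.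
have [r le_r sum_r] := exists_subsum_eq le_kE.
have r_le_lam i : (r i)%:R <= lam i.
  by rewrite (le_trans _ (eqbRL (truncn_le _) (lam_ge0 i))) // ler_nat.
exists (x - \sum_i w i *+ r i).
  rewrite latB def_x lat_sum addrAC -sumrB.
  under eq_bigr do rewrite latMn -scalerBl.
  apply: homot_polyh_comb => // [i|]; first by rewrite subr_ge0.
  by rewrite sumrB lam_sum -natr_sum sum_r mulSn natrD addrK.
rewrite opprB addrC subrK lat_sum -[X in homot _ _ X]addr0.
under eq_bigr do rewrite latMn.
apply: homot_polyh_comb; rewrite ?muln_gt0 ?k_gt0 // -?natr_sum ?sum_r //.
exact: in_dual0.
Qed.

Hypothesis E_ge : (n.-1 <= E)%N.

Lemma splittable_simplex (W : 'I_n.+1 -> 'rV[int]_n) (lam : 'I_n.+1 -> rat) x :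
  \det (vertex_mx W) != 0 -> (forall i, P (lat (W i))) -> (forall i, 0 <= lam i) ->
  \sum_i lam i = (k.+1 * E)%:R -> lat x = \sum_i lam i *: lat (W i) ->
  splittable E k x.
Proof.
have [D] := ubnP (absz (\det (vertex_mx W))).
elim: D W lam => // D IH W lam; rewrite ltnS => le_D det_W PW lam_ge0 lam_sum def_x.
have [fract_le|fract_gt] := lerP (\sum_i fract (lam i)) E%:R.
  apply: (@splittable_floor _ W lam 0 x) PW lam_ge0 lam_sum _ _ fract_le.
    exact: in_dual0.
  by rewrite addr0.
(* the fractional parts sum to an integer in (E, n + 1), and E >= n - 1 *)
have [fract_n n_gt0] : \sum_i fract (lam i) = n%:R /\ (0 < n)%N.
  have fract_lt : \sum_i fract (lam i) < n.+1%:R.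
    rewrite -[X in X%:R](card_ord n.+1) -cardsT.
    by apply: sum_fract_lt => // [i|]; rewrite ?inE // -card_gt0 cardsT card_ord.
  move: fract_gt fract_lt; rewrite sum_fract lam_sum; set A := (\sum_i _)%N => gt lt.
  have lt1 : (A + E < k.+1 * E)%N by rewrite -(ltr_nat rat) natrD; lra.
  have lt2 : (k.+1 * E < A + n.+1)%N by rewrite -(ltr_nat rat) natrD -natr1; lra.
  have -> : (k.+1 * E = A + n)%N by lia.
  by split; [rewrite natrD; ring | lia].
have [W' [lam' [[PW' lam'_ge0 lam'_sum def_x'] /andP[det_W'_gt0 lt_det]]]] :=
  simplex_exchange n_gt0 det_W PW lam_ge0 def_x fract_n.
apply: (IH W' lam') => //; first exact: leq_trans lt_det le_D.
  by rewrite -absz_gt0.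
by rewrite lam'_sum.
Qed.

Lemma splittable_small_support (I : finType) (w : I -> 'rV[int]_n) (lam : I -> rat) C x :
  (forall i, P (lat (w i))) -> (forall i, 0 <= lam i) ->
  \sum_i lam i = (k.+1 * E)%:R -> in_dual gens C ->
  lat x = \sum_i lam i *: lat (w i) + C ->
  (#|[set i | lam i != 0%R]| <= n)%N -> splittable E k x.
Proof.
move=> Pw lam_ge0 lam_sum dual_C def_x card_le.
apply: (splittable_floor Pw lam_ge0 lam_sum dual_C def_x).
have lam_out i : i \notin [set i | lam i != 0] -> lam i = 0.
  by rewrite inE negbK => /eqP.
have [supp0|supp_neq0] := eqVneq [set i | lam i != 0] set0.
  by rewrite big1 // => i _; rewrite lam_out ?supp0 ?inE // fract0.
have fract_lt : \sum_i fract (lam i) < n%:R.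
  by apply: lt_le_trans (sum_fract_lt lam_ge0 lam_out supp_neq0) _; rewrite ler_nat.
(* an integer below n is at most n - 1 <= E *)
move: fract_lt; rewrite sum_fract lam_sum; set A := (\sum_i _)%N => lt.
have lt_n : (k.+1 * E < A + n)%N by rewrite -(ltr_nat rat) natrD; lra.
have : (k.+1 * E <= A + E)%N by lia.
by rewrite -(ler_nat rat) natrD; lra.
Qed.

Lemma splittable_full_support c (mu : 'I_(size vs).+1 -> rat) x :
  supp_free (cone_vertex_family c) mu -> (forall i, 0 <= mu i) ->
  \sum_l mu (lift ord0 l) = (k.+1 * E)%:R ->
  lat x = \sum_l mu (lift ord0 l) *: lat (nth 0 vs l) ->
  #|[set l | mu (lift ord0 l) != 0]| = n.+1 -> splittable E k x.
Proof.
move=> free_mu mu_ge0 mu_sum def_x card_S.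
pose h i := enum_val (cast_ord (esym card_S) i).
have mu_out l : l \notin [set l | mu (lift ord0 l) != 0] -> mu (lift ord0 l) = 0.
  by rewrite inE negbK => /eqP.
apply: (@splittable_simplex (fun i => nth 0 vs (h i))
          (fun i => mu (lift ord0 (h i)))).
- have: row_free (\matrix_i cone_vertex_family c (lift ord0 (h i))).
    apply: (supp_free_row_free free_mu) => [i1 i2 /lift_inj/enum_val_inj/cast_ord_inj //|i].
    by have := enum_valP (cast_ord (esym card_S) i); rewrite inE.
  have -> : \matrix_i cone_vertex_family c (lift ord0 (h i)) =
            map_mx (fun z : int => z%:~R) (vertex_mx (fun i => nth 0 vs (h i))).
    by rewrite map_vertex_mx; apply/row_matrixP => i; rewrite !rowK /cone_vertex_family liftK.
  by rewrite row_free_unit unitmxE unitfE det_map_mx intr_eq0.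
- by move=> i; apply: polyh_vertex.
- by move=> i; apply: mu_ge0.
- by rewrite -mu_sum (sum_enum_supp card_S).
- by rewrite def_x (sum_enum_supp card_S) // => l /mu_out ->; rewrite scale0r.
Qed.

Lemma splittable_step x : homot (k.+1 * E) P (lat x) -> splittable E k x.
Proof.
move=> /homot_polyh_free_comb[c [mu [dual_c mu_ge0 free_mu mu_sum def_x]]].
have := card_supp_free free_mu; rewrite card_supp_ord_recl => card_le.
have [S_full|S_small] := eqVneq #|[set l | mu (lift ord0 l) != 0]| n.+1.
  have mu0 : mu ord0 = 0.
    by move: card_le; rewrite S_full; case: eqP => // _; rewrite add1n ltnn.
  apply: (splittable_full_support free_mu mu_ge0 mu_sum _ S_full).
  by rewrite def_x mu0 scale0r addr0.
apply: (@splittable_small_support _ (fun l : 'I_(size vs) => nth 0 vs l)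
          (fun l => mu (lift ord0 l)) (mu ord0 *: c) x polyh_vertex) => //.
  exact: in_dualZ.
by rewrite -ltnS ltn_neqAle S_small (leq_trans (leq_addl _ _) card_le).
Qed.

End Splitting.

Lemma homot_polyh_decomp E k x : (0 < E)%N -> (n.-1 <= E)%N -> (0 < k)%N ->
  homot (k * E) P (lat x) ->
  exists ms : 'I_k -> 'rV[int]_n, (forall j, homot E P (lat (ms j))) /\ x = \sum_j ms j.
Proof.
move=> E_gt0 E_ge; elim: k x => // k IH x _ x_in.
case: k IH x_in => [_ x_in|k IH x_in].
  by exists (fun _ => x); split; [rewrite -[E]mul1n | rewrite big_ord1].
have [m Em rest] := splittable_step E_gt0 (ltn0Sn k) E_ge x_in.
have [ms [Ems def_x]] := IH _ (ltn0Sn k) rest.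
exists (fun j => if unlift ord0 j is Some j' then ms j' else m); split.
  by move=> j; case: unlift.
rewrite big_ord_recl unlift_none (eq_bigr ms) => [|j _]; last by rewrite liftK.
by rewrite -def_x addrC subrK.
Qed.

Lemma homot_polyh_sum E k (ms : 'I_k -> 'rV[int]_n) : (0 < E)%N -> (0 < k)%N ->
  (forall j, homot E P (lat (ms j))) -> homot (k * E) P (lat (\sum_j ms j)).
Proof.
move=> E_gt0 k_gt0 /fin_all_exists[p Pp].
rewrite lat_sum -[X in homot _ _ X]addr0.
rewrite (eq_bigr (fun j => E%:R *: p j)) => [|j _]; last by case: (Pp j).
apply: homot_polyh_comb.
- by rewrite muln_gt0 k_gt0.
- by move=> j; rewrite ler0n.
- by rewrite sumr_const card_ord natrM mulr_natl.
- by move=> j; case: (Pp j).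
- exact: in_dual0.
Qed.

End Polyhedron.

Unset Implicit Arguments.
Theorem theorem3p5p6 (n : nat) (gens : seq 'rV[rat]_n) (vs : seq 'rV[int]_n) :
  strongly_convex gens ->
  forall e : nat, (0 < e)%N -> (n.-1 <= e)%N ->
    normal_polyh (homot e (polyh vs gens)).
Proof.
move=> _ E E_gt0 E_ge k k_gt0 m; split.
  by move=> /homot_homot/homot_polyh_decomp; apply.
by move=> [ms [Ems ->]]; apply/homot_homot; exact: homot_polyh_sum.
Qed.
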